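(* Consider the linear regression model $y_i=x_i^T\beta^*+u_i$, $i=1,\dots,n$, with the pairs $(y_i,x_i^T)$, $i=1,\dots,n$, independent (not necessarily identically distributed), $x_i$ random vectors in $\mathbb{R}^p$, $u_i$ real random errors and $\beta^*\in\mathbb{R}^p$ an unknown vector. Let $0<\alpha<1$ and $$r=\sqrt{\frac{2\log(4p/\alpha)}{n}}.$$ Assume that for all $i=1,\dots,n$ and $k=1,\dots,p$ the random variables $x_{ki}u_i$ are symmetric. Let $Q^*>0$ be a constant such that $$\mathbb{P}\left(\max_{k=1,\dots,p}\frac{d_{kk}^2}{n}\sum_{i=1}^n x_{ki}^2u_i^2>Q^*\right)\le \frac{\alpha}{2}.$$ Let $s$ be a positive integer and assume that $|J(\beta^* )|\le s$. For $\gamma>0$ (such that $\kappa_{1,0}^{(\gamma)}(s)>0$), set $$c=\frac{(2\gamma+1)r}{\kappa_{1,0}^{(\gamma)}(s)}.$$ Then, with probability at least $1-\alpha$, the following holds for any such $\gamma>0$ and any $\widehat\beta$ such that $(\widehat\beta,\widehat\sigma)$ is a solution, with $c=\frac{(2\gamma+1)r}{\kappa_{1,0}^{(\gamma)}(s)}$, of the minimization problem $$\min_{(\beta,\sigma)\in\widehat{\mathcal D}}\left(\left|\mathbf{D}^{-1}\beta\right|_1+c\,\sigma\right)$$ (i.e. a Self-Tuned Dantzig estimator): writing $\Delta=\mathbf{D}^{-1}(\widehat\beta-\beta^* )$, $$|\Delta|_1\le\left(\frac{(\gamma+2)(2\gamma+1)\sqrt{Q^*}}{\gamma\,\kappa_{1,0}^{(\gamma)}(s)}\right)r,$$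 $$\Delta^T\Psi_n\Delta\le\left(\frac{(\gamma+2)(2\gamma+1)^2Q^*}{\gamma^2\,\kappa_{1,0}^{(\gamma)}(s)}\right)r^2.$$
   Context: Notation: $x_{ki}$ is the $k$th component of $x_i$; $\mathbf{Y}=(y_1,\dots,y_n)^T$; $\mathbf{X}$ is the $n\times p$ matrix with rows $x_i^T$. $\mathbf{D}$ is the $p\times p$ diagonal normalizing matrix with diagonal entries $d_{kk}>0$, $k=1,\dots,p$, which may depend on the regressors; typical examples are $d_{kk}\equiv 1$, $d_{kk}=(\frac1n\sum_{i=1}^n x_{ki}^2)^{-1/2}$, and $d_{kk}=(\max_{i=1,\dots,n}|x_{ki}|)^{-1}$. For $1\le q\le\infty$, $|\cdot|_q$ is the $\ell_q$ norm of a vector. $J(\beta)=\{k\in\{1,\dots,p\}:\beta_k\neq 0\}$ is the support of $\beta\in\mathbb{R}^p$, and $|J|$ denotes the cardinality of a set $J$. The matrix $\Psi_n$ is $\Psi_n=\frac1n\mathbf{D}\mathbf{X}^T\mathbf{X}\mathbf{D}$. The (random) constraint set is $$\widehat{\mathcal D}=\left\{(\beta,\sigma):\ \beta\in\mathbb{R}^p,\ \sigma>0,\ \left|\frac1n\mathbf{D}\mathbf{X}^T(\mathbf{Y}-\mathbf{X}\beta)\right|_\infty\le\sigma r\right\},$$ with the value of $r$ given in the claim. For $\gamma>0$ and a positive integer $s$, the data-dependent quantity $\kappa_{1,0}^{(\gamma)}(s)$ is $$\kappa_{1,0}^{(\gamma)}(s)=\frac1s\min_{k=1,\dots,p}\ \min\left\{|\Psi_n\Delta|_\infty:\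 \Delta\in\mathbb{R}^p,\ \Delta_k=1,\ |\Delta|_1\le(2+\gamma)s\right\}.$$ *)

(* Defs.v *)
From HB Require Import structures.
From mathcomp Require Import all_boot all_order all_algebra.
From mathcomp Require Import all_classical all_reals all_analysis.

Set Implicit Arguments.
Unset Strict Implicit.
Unset Printing Implicit Defensive.

Import Order.TTheory GRing.Theory Num.Theory.
Import numFieldNormedType.Exports.

Local Open Scope classical_set_scope.
Local Open Scope ring_scope.

Definition mutually_independent d (T : measurableType d) (R : realType)
    (P : probability T R) d' (T' : measurableType d') (I : finType)
    (Z : I -> T -> T') : Prop :=
  forall (J : {set I}) (B : I -> set T'), (forall i, measurable (B i)) ->
    P (\bigcap_(i in [set` J]) (Z i @^-1` B i)) =
    (\prod_(i in J) P (Z i @^-1` B i))%E.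

Definition symmetric_rv d (T : measurableType d) (R : realType)
    (P : probability T R) (Z : T -> R) : Prop :=
  forall B : set R, measurable B ->
    P [set w | B (Z w)] = P [set w | B (- Z w)].

(* The l_oo norm is the library norm `|v| on matrices (maximum of the absolute
   values of the entries, see mx_normrE). *)
Definition l1norm (R : realType) (p : nat) (v : 'cV[R]_p) : R :=
  \sum_(k < p) `|v k 0|.

Definition vsupport (R : realType) (p : nat) (b : 'cV[R]_p) : {set 'I_p} :=
  [set k | b k 0 != 0]%SET.

Definition design (T : Type) (R : realType) (n p : nat)
    (x : 'I_n -> T -> p.-tuple R) (w : T) : 'M[R]_(n, p) :=
  \matrix_(i < n, k < p) tnth (x i w) k.

Definition response (T : Type) (R : realType) (n : nat)
    (y : 'I_n -> T -> R) (w : T) : 'cV[R]_n :=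
  \col_(i < n) y i w.

(* The normalization is a function of the n x p design matrix, which makes
   "may depend on the regressors" precise. *)
Definition normalizer (R : realType) (n p : nat)
    (dg : 'I_p -> 'M[R]_(n, p) -> R) (X : 'M[R]_(n, p)) : 'M[R]_p :=
  diag_mx (\row_(k < p) dg k X).

Definition Psi (R : realType) (n p : nat) (D : 'M[R]_p) (X : 'M[R]_(n, p)) :
    'M[R]_p :=
  n%:R^-1 *: (D *m X^T *m X *m D).

Definition dantzig_set (R : realType) (n p : nat) (D : 'M[R]_p)
    (X : 'M[R]_(n, p)) (Y : 'cV[R]_n) (r : R) : set ('cV[R]_p * R) :=
  [set bs | 0 < bs.2 /\
    `|n%:R^-1 *: (D *m X^T *m (Y - X *m bs.1))| <= bs.2 * r].

Definition self_tuned_dantzig (R : realType) (n p : nat) (D : 'M[R]_p)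
    (X : 'M[R]_(n, p)) (Y : 'cV[R]_n) (r c : R) (bs : 'cV[R]_p * R) : Prop :=
  dantzig_set D X Y r bs /\
  forall bs', dantzig_set D X Y r bs' ->
    l1norm (invmx D *m bs.1) + c * bs.2 <= l1norm (invmx D *m bs'.1) + c * bs'.2.

(* For p, s >= 1 and gamma > 0 both infima are attained: the inner one is that
   of a continuous function on a nonempty compact set, the outer one ranges
   over a nonempty finite set. *)
Definition kappa10 (R : realType) (p : nat) (M : 'M[R]_p) (gamma : R)
    (s : nat) : R :=
  s%:R^-1 *
  inf [set inf [set `|M *m v| | v in
                  [set v : 'cV[R]_p | v k 0 = 1 /\ l1norm v <= (2 + gamma) * s%:R]]
      | k in [set: 'I_p]].

(* Main.v *)
(* Put Z_ki = x_ki u_i. Flipping the signs of independent symmetric variables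
   preserves their joint law, so conditionally on the |Z_ki| the sum over i is a
   Rademacher sum, and Hoeffding's bound (from cosh x <= exp(x^2/2)) gives
   P(|sum_i Z_ki| > t (sum_i Z_ki^2)^(1/2)) <= 2 exp(-t^2/2); the factor d_kk
   cancels, so it may depend on the design. A union bound over k shows that with
   probability at least 1 - alpha the pair (beta*, sqrt Q* ) is feasible.
   On this event the minimality of the estimator bounds the mass of Delta off
   J(beta* ). Either Delta lies in the cone |Delta|_1 <= (2+gamma)|Delta_J|_1,
   and the sensitivity kappa controls |Delta_J|_1 and sigma^ through
   |Psi Delta|_oo <= r (sigma^ + sqrt Q* ), or it does not, and minimality alone
   bounds |Delta|_1 and forces sigma^ < sqrt Q*. *)
Require Import Defs.
From HB Require Import structures.
From mathcomp Require Import all_boot all_order all_algebra.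
From mathcomp Require Import all_classical all_reals all_analysis.
From mathcomp Require Import measurable_realfun ring lra.

Set Implicit Arguments.
Unset Strict Implicit.
Unset Printing Implicit Defensive.

Import Order.TTheory GRing.Theory Num.Theory.
Import numFieldNormedType.Exports.

Local Open Scope classical_set_scope.
Local Open Scope ring_scope.

(** * Exponential tail bounds for Rademacher sums *)

Lemma ge0_derive_le0r (R : realType) (f df : R -> R) (x : R) :
  (forall z : R, is_derive z 1 f (df z)) -> (forall z, 0 <= z -> 0 <= df z) ->
  0 <= x -> f 0 <= f x.
Proof.
move=> fE df0; rewrite le_eqVlt => /predU1P[<-//|x0].
have cf : {within `[0, x], continuous f}.
  apply: continuous_subspaceT => z.
  by apply: differentiable_continuous; apply/derivable1_diffP; case: (fE z).
have [z] := MVT x0 (fun z _ => fE z) cf.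
rewrite in_itv/= => /andP[z0 _]; rewrite subr0 => fxE.
by rewrite -subr_ge0 fxE mulr_ge0 ?df0 ?ltW.
Qed.

(** By evenness take [x >= 0]. The function [g z = - exp(-z^2/2) (exp z + exp(-z))] has derivative
    [exp(-z^2/2) * h z], and [h] is nonnegative on [z >= 0] because [h 0 = 0] and its derivative is
    [z (exp z - exp(-z))]. Comparing [g 0 = -2] with [g x] gives the claim. *)
Lemma expRDN_le (R : realType) (x : R) :
  expR x + expR (- x) <= 2 * expR (x ^+ 2 / 2).
Proof.
wlog x0 : x / 0 <= x.
  move=> h; have [/h//|/ltW x0] := leP 0 x.
  by have := h (- x); rewrite oppr_ge0 opprK sqrrN addrC => /(_ x0).
pose h (z : R) := z * (expR z + expR (- z)) - (expR z - expR (- z)).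
have h0 : h 0 = 0 by rewrite /h mul0r oppr0 expR0 subrr subrr.
have h_ge0 z : 0 <= z -> 0 <= h z.
  move=> z0; rewrite -h0; move: z0.
  apply: (@ge0_derive_le0r _ h (fun y => y * (expR y - expR (- y)))) => y.
    rewrite /h; apply: is_derive_eq.
    by rewrite /GRing.scale/=; ring.
  move=> y0; rewrite mulr_ge0// subr_ge0 ler_expR; lra.
pose g (z : R) := - (expR (- (z ^+ 2 / 2)) * (expR z + expR (- z))).
have : g 0 <= g x.
  apply: (@ge0_derive_le0r _ g (fun y => expR (- (y ^+ 2 / 2)) * h y)) => // y.
    rewrite /g /h; apply: is_derive_eq.
    by rewrite /GRing.scale/=; field.
  by move=> y0; rewrite mulr_ge0 ?expR_ge0// h_ge0.
rewrite /g lerN2 expr0n/= mul0r oppr0 expR0 mul1r expRN mulrC.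
by rewrite ler_pdivrMr ?expR_gt0.
Qed.

(** Hoeffding's inequality in counting form: the number of sign vectors in the tail is compared with
    all [2 ^+ n] of them. The proof is Chernoff's method, bounding each indicator by an
    exponential. *)
Lemma rademacher_tail (R : realType) n (a : 'I_n -> R) (t : R) : 0 < t ->
  \sum_(e : {ffun 'I_n -> bool})
    (t * Num.sqrt (\sum_i a i ^+ 2) < \sum_i (-1) ^+ e i * a i)%R%:R
  <= 2 ^+ n * expR (- (t ^+ 2 / 2)) :> R.
Proof.
move=> t0; set V := \sum_i a i ^+ 2.
have V0 : 0 <= V by apply: sumr_ge0 => i _; exact: sqr_ge0.
(* If [V = 0] all coefficients vanish, and the strict comparison [0 < 0] makes every indicator
   zero. *)
move: (V0); rewrite le_eqVlt => /predU1P[VE|Vgt0].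
  have a0 i : a i = 0.
    by apply/eqP; rewrite -sqrf_eq0; move/esym/psumr_eq0P: VE => ->// j _;
      exact: sqr_ge0.
  rewrite big1 ?mulr_ge0 ?exprn_ge0 ?expR_ge0// => e _.
  rewrite -VE sqrtr0 mulr0 big1 ?ltxx// => i _; by rewrite a0 mulr0.
pose v := Num.sqrt V; have v0 : 0 < v by rewrite sqrtr_gt0.
(* This value minimizes the Chernoff exponent [l^2 V / 2 - l t v], whose minimum is [- t^2 / 2]. *)
pose l := t / v; have l0 : 0 < l by rewrite divr_gt0.
have vl : l * (t * v) = t ^+ 2 by rewrite /l; field; rewrite gt_eqF.
have lV : l ^+ 2 * V = t ^+ 2.
  by rewrite -(sqr_sqrtr V0) -/v /l; field; rewrite gt_eqF.
apply: (@le_trans _ _ (\sum_(e : {ffun 'I_n -> bool})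
    expR (- t ^+ 2) * \prod_i expR (l * ((-1) ^+ e i * a i)))).
  apply: ler_sum => e _; rewrite -expR_sum -expRD -mulr_sumr.
  case: ltP => [tS|_]; last exact: expR_ge0.
  rewrite (le_trans _ (expR_ge1Dx _))// lerDl addrC subr_ge0 -vl.
  by rewrite ler_pM2l// ltW.
rewrite -mulr_sumr.
(* The sum over sign vectors of a product factors into a product over coordinates of two-term sums,
   each of which is twice a hyperbolic cosine. *)
rewrite -(bigA_distr_bigA (fun i (b : bool) => expR (l * ((-1) ^+ b * a i)))).
apply: (@le_trans _ _ (expR (- t ^+ 2) *
    \prod_(i < n) (2 * expR ((l * a i) ^+ 2 / 2)))).
  rewrite ler_wpM2l ?expR_ge0//; apply: ler_prod => i _.
  rewrite big_bool expr1 expr0 mulN1r mul1r mulrN addr_ge0 ?expR_ge0//=.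
  by rewrite addrC expRDN_le.
rewrite big_split/= prodr_const card_ord -expR_sum mulrCA -expRD.
rewrite ler_pM2l ?exprn_gt0// ler_expR.
rewrite -mulr_suml (eq_bigr (fun i => l ^+ 2 * a i ^+ 2)); last first.
  by move=> i _; rewrite exprMn.
by rewrite -mulr_sumr lV; lra.
Qed.

Lemma rademacher_tail_abs (R : realType) n (a : 'I_n -> R) (t : R) : 0 < t ->
  \sum_(e : {ffun 'I_n -> bool})
    (t * Num.sqrt (\sum_i a i ^+ 2) < `|\sum_i (-1) ^+ e i * a i|)%R%:R
  <= 2 ^+ n * (2 * expR (- (t ^+ 2 / 2))) :> R.
Proof.
move=> t0; have h := rademacher_tail a t0.
have := rademacher_tail (fun i => - a i) t0.
under eq_bigr do under [X in Num.sqrt X]eq_bigr do rewrite sqrrN.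
under eq_bigr do under [X in _ < X]eq_bigr do rewrite mulrN.
under eq_bigr do rewrite sumrN.
move=> h'; rewrite mulrCA mulr_natl mulr2n.
apply: le_trans (lerD h h'); rewrite -big_split/=.
apply: ler_sum => e _; rewrite lter_normr -natrD ler_nat.
by do 2 case: (_ < _).
Qed.

(** * Joint laws of independent variables *)

Lemma measurable_tuple_rect d (T : sigmaRingType d) n (B : 'I_n -> set T) :
  (forall i, measurable (B i)) ->
  measurable ([set z | forall i, B i (tnth z i)] : set (n.-tuple T)).
Proof.
move=> mB.
rewrite (_ : [set z | _] =
    \bigcap_(i in setT) ((@tnth n T)^~ i @^-1` B i)); last first.
  by apply/seteqP; split => z /= Bz i => [_|]; exact: Bz.
apply: fin_bigcap_measurable => // i _.
by rewrite -[X in measurable X]setTI; exact: measurable_tnth.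
Qed.

(** The product sigma-algebra is generated by one-coordinate cylinders, and a cylinder is a
    rectangle with [setT] in the other coordinates. Rectangles are used as generators because they
    are stable under intersection, as uniqueness of measures demands. *)
Lemma measurable_tuple_rectE d (T : measurableType d) n :
  @measurable _ (n.-tuple T) =
  <<s [set A : set (n.-tuple T) | exists B : 'I_n -> set T,
     (forall i, measurable (B i)) /\ A = [set z | forall i, B i (tnth z i)]] >>.
Proof.
apply/seteqP; split.
  apply: smallest_sub; first exact: smallest_sigma_algebra.
  move=> A. rewrite -bigcup_seq => -[i _ [B mB <-]].
  apply: sub_sigma_algebra.
  exists (fun j => if j == i then B else setT); split.
    by move=> j; case: ifP.
  rewrite setTI; apply/seteqP; split => z /=.
    by move=> Bz j; case: eqP => // ->.
  by move/(_ i); rewrite eqxx.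
apply: smallest_sub.
  exact: sigma_algebra_measurable.
by move=> _ [B [mB ->]]; exact: measurable_tuple_rect.
Qed.

Lemma mutually_independent_comp d (T : measurableType d) (R : realType)
    (P : probability T R) d1 (T1 : measurableType d1) d2
    (T2 : measurableType d2) (I : finType) (Z : I -> T -> T1)
    (f : I -> T1 -> T2) :
  (forall i, measurable_fun setT (f i)) -> mutually_independent P Z ->
  mutually_independent P (fun i => f i \o Z i).
Proof.
move=> mf indZ J B mB; apply: (indZ J (fun i => f i @^-1` B i)) => i.
by rewrite -[X in measurable X]setTI; exact: mf.
Qed.

(** By independence both tuple laws give a rectangle the product of its marginal probabilities, and
    these agree by hypothesis. Two finite measures that agree on an intersection-stable generating
    family coincide. *)
Lemma eq_joint_law d (T : measurableType d) (R : realType)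
    (P : probability T R) d' (T' : measurableType d') n
    (Z Z' : 'I_n -> T -> T') (A : set (n.-tuple T')) :
  (forall i, measurable_fun setT (Z i)) ->
  (forall i, measurable_fun setT (Z' i)) ->
  mutually_independent P Z -> mutually_independent P Z' ->
  (forall i B, measurable B -> P (Z i @^-1` B) = P (Z' i @^-1` B)) ->
  measurable A ->
  P [set w | A [tuple Z i w | i < n]] = P [set w | A [tuple Z' i w | i < n]].
Proof.
move=> mZ mZ' indZ indZ' eqZ mA.
have mtuple (Y : 'I_n -> T -> T') : (forall i, measurable_fun setT (Y i)) ->
    measurable_fun setT (fun w => [tuple Y i w | i < n]).
  move=> mY; apply/measurable_fun_tnthP => i.
  by apply: eq_measurable_fun (mY i) => w _ /=; rewrite tnth_mktuple.
have rectE (Y : 'I_n -> T -> T') (B : 'I_n -> set T') :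
    (forall i, measurable (B i)) -> mutually_independent P Y ->
    P [set w | forall i, B i (tnth [tuple Y i w | i < n] i)] =
    (\prod_(i in [set: 'I_n]%SET) P (Y i @^-1` B i))%E.
  move=> mB indY; rewrite -(indY _ _ mB); congr (P _).
  apply/seteqP; split => w /= Bw i => [_|].
    by have := Bw i; rewrite tnth_mktuple.
  by rewrite tnth_mktuple; apply: Bw; rewrite /= inE.
pose X : {mfun T >-> n.-tuple T'} :=
  HB.pack (fun w => [tuple Z i w | i < n])
    (isMeasurableFun.Build _ _ _ _ _ (mtuple _ mZ)).
pose X' : {mfun T >-> n.-tuple T'} :=
  HB.pack (fun w => [tuple Z' i w | i < n])
    (isMeasurableFun.Build _ _ _ _ _ (mtuple _ mZ')).
apply: (measure_unique _ (fun=> setT) (measurable_tuple_rectE T' n) _ _ _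
  (pushforward P X) (pushforward P X')) => //.
- move=> _ _ [B [mB ->]] [C [mC ->]]; exists (fun i => B i `&` C i); split.
    by move=> i; exact: measurableI.
  apply/seteqP; split => z /=; first by move=> [Bz Cz] i; split.
  by move=> BCz; split=> i; case: (BCz i).
- by move=> _; exists (fun=> setT); split => //; apply/seteqP; split.
- by rewrite bigcup_const.
- move=> _ [B [mB ->]]; rewrite [LHS](rectE Z)// [RHS](rectE Z')//.
  by apply: eq_bigr => i _; exact: eqZ.
- by move=> _; rewrite [ltLHS](probability_setT P) ltry.
Qed.

(** * Self-normalized sums of independent symmetric variables *)

Lemma measurable_set_ltr d (T : measurableType d) (R : realType)
    (f g : T -> R) : measurable_fun setT f -> measurable_fun setT g ->
  measurable [set w | f w < g w].
Proof.
move=> mf mg; rewrite -[X in measurable X]setTI.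
by have := measurable_fun_ltr mf mg measurableT (Y := [set true]); apply.
Qed.

Lemma measurable_self_normalized_tail d (T : measurableType d) (R : realType)
    n (Z : 'I_n -> T -> R) (t : R) : (forall i, measurable_fun setT (Z i)) ->
  measurable [set w | t * Num.sqrt (\sum_i Z i w ^+ 2) < `|\sum_i Z i w|].
Proof.
move=> mZ; apply: measurable_set_ltr.
  apply: measurable_funM => //.
  apply: (measurableT_comp (f := @Num.sqrt R)).
    by apply: nondecreasing_measurable => // x y; exact: ler_wsqrtr.
  by apply: measurable_sum => i; exact: measurable_funX.
by apply: measurableT_comp => //; exact: measurable_sum.
Qed.

(** Averaging over sign vectors takes the place of conditioning on the absolute values. Each flipped
    event [S e] has the probability of the original one, so [2 ^+ n] times that probability is the
    expected number of [e] with [w] in [S e], which the Rademacher bound controls for every [w]. *)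
Lemma self_normalized_tail d (T : measurableType d) (R : realType)
    (P : probability T R) n (Z : 'I_n -> T -> R) (t : R) :
  (forall i, measurable_fun setT (Z i)) -> mutually_independent P Z ->
  (forall i, symmetric_rv P (Z i)) -> 0 < t ->
  (P [set w | (t * Num.sqrt (\sum_i Z i w ^+ 2) < `|\sum_i Z i w|)%R]
    <= (2 * expR (- (t ^+ 2 / 2)))%:E)%E.
Proof.
move=> mZ indZ symZ t0; set c := 2 * expR _.
pose A := [set z : n.-tuple R |
  t * Num.sqrt (\sum_i tnth z i ^+ 2) < `|\sum_i tnth z i|].
have mA : measurable A.
  by apply: measurable_self_normalized_tail => i; exact: measurable_tnth.
pose S (e : {ffun 'I_n -> bool}) := [set w | A [tuple (-1) ^+ e i * Z i w | i < n]].
have mS e : measurable (S e).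
  rewrite -[X in measurable X]setTI.
  have : measurable_fun setT (fun w => [tuple (-1) ^+ e i * Z i w | i < n]).
    apply/measurable_fun_tnthP => i.
    apply: (@eq_measurable_fun _ _ _ _ _ (fun w => (-1) ^+ e i * Z i w)).
      by move=> w _ /=; rewrite tnth_mktuple.
    exact: measurable_funM.
  by apply.
have PS e : P (S e) = P [set w | A [tuple Z i w | i < n]].
  apply: (@eq_joint_law _ _ _ P _ R n (fun i w => (-1) ^+ e i * Z i w) Z A) => //.
  - by move=> i; exact: measurable_funM.
  - apply: (@mutually_independent_comp _ _ _ P _ R _ R _ Z
      (fun i x => (-1) ^+ e i * x)) => // i.
    exact: measurable_funM.
  - move=> i B mB; case: (e i); last first.
      by congr (P _); apply/funext => w /=; rewrite /preimage/= expr0 mul1r.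
    transitivity (P [set w | B (- Z i w)]); last exact/esym/symZ.
    by congr (P _); apply/funext => w /=; rewrite /preimage/= expr1 mulN1r.
have -> : [set w | t * Num.sqrt (\sum_i Z i w ^+ 2) < `|\sum_i Z i w|] =
    [set w | A [tuple Z i w | i < n]].
  apply/funext => w; rewrite /A/=.
  under [in RHS]eq_bigr do rewrite tnth_mktuple.
  by under [\sum_(i < n) tnth _ i]eq_bigr do rewrite tnth_mktuple.
have : (\sum_e P (S e) <= (2 ^+ n * c)%:E)%E.
  under eq_bigr do rewrite -[S _]setIT -integral_indic//.
  rewrite -ge0_integral_sum//; last first.
    by move=> e; apply/measurable_EFinP; exact: measurable_indic.
  rewrite -[leRHS]mule1 -(probability_setT P) -integral_cst//.
  apply: ge0_le_integral => //.
  - by move=> w _; apply: sume_ge0 => e _; rewrite lee_fin.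
  - apply: emeasurable_sum => e; apply/measurable_EFinP; exact: measurable_indic.
  - move=> w _; rewrite sumEFin lee_fin.
    apply: le_trans (rademacher_tail_abs (fun i => Z i w) t0).
    apply: ler_sum => e _; rewrite indicE.
    case: (boolP (w \in S e)) => // /set_mem; rewrite /S /A /=.
    (* Sign flips do not change the sum of squares, so the threshold in [S e] is the one of the
       Rademacher bound with coefficients [Z i w]. *)
    under eq_bigr do rewrite tnth_mktuple exprMn sqrr_sign mul1r.
    under [\sum_(i < n) tnth _ i]eq_bigr do rewrite tnth_mktuple.
    by move=> ->.
have /fineK PE : P [set w | A [tuple Z i w | i < n]] \is a fin_num.
  by rewrite -(PS [ffun=> false]) fin_num_measure.
under eq_bigr do rewrite [P _]PS -PE.
rewrite sumEFin -PE !lee_fin sumr_const card_ffun card_bool card_ord.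
by rewrite -[leLHS]mulr_natl natrX ler_pM2l// exprn_gt0.
Qed.

(** * Sensitivity, cone condition and deterministic error bounds *)

Lemma mx_norm_ge_entry (R : realDomainType) m n (M : 'M[R]_(m, n)) i j :
  `|M i j| <= mx_norm M.
Proof.
rewrite mx_normrE.
exact: (le_bigmax _ (fun ij : 'I_m * 'I_n => `|M ij.1 ij.2|) (i, j)).
Qed.

Lemma mulmx_trl_le_l1norm (R : realType) p (v w : 'cV[R]_p) :
  (v^T *m w) 0 0 <= l1norm v * `|w|.
Proof.
rewrite mxE /l1norm mulr_suml; apply: ler_sum => k _; rewrite mxE.
by rewrite (le_trans (ler_norm _))// normrM ler_wpM2l// mx_norm_ge_entry.
Qed.

(** Homogeneity: dividing [v] by its entry [a] of largest absolute value, at index [k], gives a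
    vector with [k]-th entry 1 and l1 norm at most [(2 + gamma) * s]. It is a competitor in the
    inner infimum at [k], which bounds the outer infimum from above. *)
Lemma kappa10_le (R : realType) p (M : 'M[R]_p) (gamma : R) s (v : 'cV[R]_p) :
  (0 < s)%N -> l1norm v <= (2 + gamma) * s%:R * `|v| ->
  s%:R * kappa10 M gamma s * `|v| <= `|M *m v|.
Proof.
move=> s0 vcone; have [->|v0] := eqVneq v 0; first by rewrite normr0 mulr0.
have [[k j] /= vE] : exists ij, `|v| = `|v ij.1 ij.2|.
  by apply: mx_norm_neq0; apply: contra v0 => /eqP/mx_norm_eq0 ->.
rewrite (ord1 j) {j} in vE; set a := v k 0 in vE.
have a0 : 0 < `|a| by rewrite -vE normr_gt0.
pose v' := a^-1 *: v.
rewrite /kappa10 mulrA mulfV ?pnatr_eq0 -?lt0n// mul1r.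
have Mv' : `|M *m v| = `|M *m v'| * `|a|.
  by rewrite -scalemxAr normrZ normfV mulrAC mulVf ?mul1r// gt_eqF.
rewrite Mv' vE ler_pM2r//.
pose S j := [set `|M *m v| | v in
  [set v : 'cV[R]_p | v j 0 = 1 /\ l1norm v <= (2 + gamma) * s%:R]].
have S_ge0 j : lbound (S j) 0 by move=> _ [z _ <-].
have infS_ge0 j : 0 <= inf (S j).
  (* An empty feasible set is harmless: the infimum of the empty set is 0 by convention. *)
  have [->|/set0P S0] := eqVneq (S j) set0; first by rewrite inf0.
  exact: lb_le_inf.
apply: (@le_trans _ _ (inf (S k))).
  apply: ge_inf; last by exists k.
  by exists 0 => _ [j _ <-]; exact: infS_ge0.
apply: ge_inf; first by exists 0; exact: S_ge0.
exists v' => //; split; first by rewrite mxE mulVf// -normr_gt0.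
rewrite /l1norm (eq_bigr (fun k => `|a|^-1 * `|v k 0|)); last first.
  by move=> i _; rewrite mxE normrM normfV.
by rewrite -mulr_sumr ler_pdivrMl// mulrC -vE.
Qed.

Lemma in_vsupport (R : realType) p (b : 'cV[R]_p) k :
  (k \in vsupport b) = (b k 0 != 0).
Proof. by rewrite finset.inE. Qed.

(** Off the support of [b], the entries of [h] and [h - b] coincide; on it, the triangle inequality
    bounds [b] by [h] and [h - b]. The slack [c] will hold the difference of the two penalties on
    sigma. *)
Lemma l1norm_cone (R : realType) p (h b : 'cV[R]_p) (c : R) :
  l1norm h <= l1norm b + c ->
  \sum_(k | k \notin vsupport b) `|(h - b) k 0| <=
    \sum_(k in vsupport b) `|(h - b) k 0| + c.
Proof.
rewrite /l1norm (bigID (mem (vsupport b)))/=.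
rewrite [X in _ <= X + _](bigID (mem (vsupport b)))/=.
rewrite [X in _ <= _ + X + _]big1; last first.
  by move=> k; rewrite in_vsupport negbK => /eqP ->; rewrite normr0.
rewrite addr0 [X in _ + X <= _](eq_bigr (fun k => `|(h - b) k 0|)); last first.
  by move=> k; rewrite in_vsupport negbK !mxE => /eqP ->; rewrite subr0.
set A := \sum_(_ in _) _; set B := \sum_(_ | _) _; set C := \sum_(_ in _) _.
set E := \sum_(_ in _) _.
suff : C <= A + E by lra.
rewrite /C /A /E -big_split/=; apply: ler_sum => k _; rewrite !mxE.
by rewrite -{1}(subrK (h k 0) (b k 0)) (le_trans (ler_normD _ _))// addrC distrC.
Qed.

(** The scalar core. In the application [q] is [r / kappa], [st] and [sh] are the true and estimated
    noise levels, and [a1], [a2] are the l1 masses of Delta on and off the support. The two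
    hypotheses are minimality and the sensitivity bound, the latter available only in the cone. *)
Lemma dantzig_arith (R : realFieldType) (g q st sh a1 a2 : R) :
  0 < g -> 0 < q -> 0 < st -> 0 < sh -> 0 <= a1 -> 0 <= a2 ->
  a2 <= a1 + (2 * g + 1) * q * (st - sh) ->
  (a1 + a2 <= (2 + g) * a1 -> a1 <= q * (sh + st)) ->
  g * (sh + st) <= (2 * g + 1) * st /\
  g * (a1 + a2) <= (g + 2) * (2 * g + 1) * q * st.
Proof.
move=> g0 q0 st0 sh0 a10 a20 cone sens.
have [small|] := leP (a1 + a2) ((2 + g) * a1).
  have {sens} a1q := sens small.
  (* Combining [0 <= a2] with both bounds and dividing by [q] gives
     [0 <= (sh + st) + (2 * g + 1) * (st - sh)], that is [g * sh <= (g + 1) * st]. *)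
  have h : g * (sh + st) <= (2 * g + 1) * st by rewrite -(ler_pM2l q0); lra.
  split=> //; apply: (@le_trans _ _ (g * ((2 + g) * (q * (sh + st))))).
    by rewrite ler_pM2l// (le_trans small)// ler_pM2l//; lra.
  have : (2 + g) * q * (g * (sh + st)) <= (2 + g) * q * ((2 * g + 1) * st).
    by rewrite ler_pM2l// mulr_gt0//; lra.
  lra.
move=> {sens} large; pose c := (2 * g + 1) * q.
have c0 : 0 < c by rewrite mulr_gt0//; lra.
rewrite -/c in cone.
(* Outside the cone [a2 > (1 + g) * a1], so minimality alone bounds [a1] and forces [sh < st]. *)
have h1 : g * a1 < c * (st - sh) by lra.
have h2 : 0 < st - sh.
  by rewrite -(pmulr_rgt0 _ c0) (le_lt_trans _ h1)// mulr_ge0// ltW.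
split; first by have := mulr_gt0 g0 h2; lra.
have h3 : 0 < (2 + g) * (c * sh) by rewrite !mulr_gt0//; lra.
have h4 : g * a2 <= g * (a1 + c * (st - sh)) by rewrite ler_pM2l.
rewrite /c in h1 h3 h4 *; lra.
Qed.

(** The factor [D] in [Psi] cancels [invmx D], leaving the difference of the two score vectors; each
    is bounded by its own feasibility constraint. *)
Lemma dantzig_set_residual (R : realType) n p (D : 'M[R]_p) (X : 'M[R]_(n, p))
    (Y : 'cV[R]_n) (r : R) (b1 b2 : 'cV[R]_p) (s1 s2 : R) :
  D \in unitmx -> dantzig_set D X Y r (b1, s1) -> dantzig_set D X Y r (b2, s2) ->
  `|Psi D X *m (invmx D *m (b1 - b2))| <= r * (s1 + s2).
Proof.
move=> Du [_ /= h1] [_ /= h2].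
have -> : Psi D X *m (invmx D *m (b1 - b2)) =
    n%:R^-1 *: (D *m X^T *m (Y - X *m b2)) - n%:R^-1 *: (D *m X^T *m (Y - X *m b1)).
  rewrite -scalerBr -mulmxBr.
  have -> : Y - X *m b2 - (Y - X *m b1) = X *m (b1 - b2).
    by rewrite opprB addrC addrA subrK mulmxBr.
  by rewrite /Psi -scalemxAl !mulmxA (mulmxK Du).
by rewrite (le_trans (ler_normB _ _))// mulrC mulrDl addrC lerD.
Qed.

(** Purely deterministic: the noise enters only through the feasibility of [(b, st)]. The quadratic
    form is bounded by duality, as the l1 norm of Delta times the sup norm of [Psi D X *m Delta]. *)
Lemma self_tuned_dantzig_bounds (R : realType) n p (D : 'M[R]_p)
    (X : 'M[R]_(n, p)) (Y : 'cV[R]_n) (r gamma : R) s (b bh : 'cV[R]_p)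
    (st sh : R) :
  let kappa := kappa10 (Psi D X) gamma s in
  let Delta := invmx D *m (bh - b) in
  D \in unitmx -> (0 < s)%N -> (#|vsupport (invmx D *m b)| <= s)%N ->
  0 < r -> 0 < gamma -> 0 < kappa ->
  dantzig_set D X Y r (b, st) ->
  self_tuned_dantzig D X Y r ((2 * gamma + 1) * r / kappa) (bh, sh) ->
  l1norm Delta <= (gamma + 2) * (2 * gamma + 1) * st / (gamma * kappa) * r /\
  (Delta^T *m Psi D X *m Delta) 0 0 <=
    (gamma + 2) * (2 * gamma + 1) ^+ 2 * st ^+ 2 / (gamma ^+ 2 * kappa) * r ^+ 2.
Proof.
move=> kappa Delta Du s0 cardJ r0 g0 k0 Db [Dbh minbh].
have ksens := @kappa10_le R p (Psi D X) gamma s Delta s0.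
rewrite -/kappa in ksens; clearbody kappa.
have [/= st0 _] := Db; have [/= sh0 _] := Dbh.
have residual : `|Psi D X *m Delta| <= r * (sh + st).
  exact: dantzig_set_residual Dbh Db.
have DeltaE : Delta = invmx D *m bh - invmx D *m b by rewrite /Delta mulmxBr.
pose J := vsupport (invmx D *m b).
pose a1 := \sum_(k in J) `|Delta k 0|.
pose a2 := \sum_(k | k \notin J) `|Delta k 0|.
have l1E : l1norm Delta = a1 + a2 by rewrite /l1norm (bigID (mem J)).
have cone : a2 <= a1 + (2 * gamma + 1) * (r / kappa) * (st - sh).
  rewrite /a1 /a2 DeltaE l1norm_cone//.
  by have /= := minbh _ Db; lra.
have a1_le : a1 <= s%:R * `|Delta|.
  apply: (@le_trans _ _ (\sum_(k in J) `|Delta|)).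
    by apply: ler_sum => k _; exact: mx_norm_ge_entry.
  by rewrite sumr_const -[leLHS]mulr_natl ler_wpM2r// ler_nat.
(* Since [J] has at most [s] elements, [a1 <= s * |Delta|_oo]. This puts Delta in the domain of
   [kappa10_le] and yields [kappa * a1 <= kappa * s * |Delta|_oo <= |Psi Delta|_oo]. *)
have sens : a1 + a2 <= (2 + gamma) * a1 -> a1 <= r / kappa * (sh + st).
  move=> small; rewrite mulrAC ler_pdivlMr// mulrC.
  apply: le_trans residual; apply: le_trans (ksens _).
    by rewrite (mulrC s%:R) -mulrA ler_pM2l.
  rewrite l1E (le_trans small)// -mulrA ler_pM2l//; lra.
have a10 : 0 <= a1 by exact: sumr_ge0.
have a20 : 0 <= a2 by exact: sumr_ge0.
have [sigma_le l1_le] := dantzig_arith g0 (divr_gt0 r0 k0) st0 sh0 a10 a20 cone sens.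
have l1_bound : l1norm Delta <=
    (gamma + 2) * (2 * gamma + 1) * st / (gamma * kappa) * r.
  rewrite l1E -(ler_pM2l g0) (le_trans l1_le)// le_eqVlt; apply/orP; left.
  by apply/eqP; field; rewrite !gt_eqF.
split=> //.
rewrite -mulmxA (le_trans (mulmx_trl_le_l1norm _ _))//.
(* The target splits as the l1 bound times [r] times the bound on [sh + st] given by [sigma_le]. *)
have -> : (gamma + 2) * (2 * gamma + 1) ^+ 2 * st ^+ 2 /
    (gamma ^+ 2 * kappa) * r ^+ 2 = (gamma + 2) * (2 * gamma + 1) * st / (gamma * kappa) * r *
    (r * ((2 * gamma + 1) * st / gamma)).
  by field; rewrite !gt_eqF.
apply: ler_pM => //; first by rewrite l1E addr_ge0.
by rewrite (le_trans residual)// ler_pM2l// ler_pdivlMr// mulrC.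
Qed.

(** * Union bound, normalization and the probabilistic conclusion *)

Lemma measurable_bigmaxr d (T : measurableType d) (R : realType) (I : Type)
    (s : seq I) (c : R) (f : I -> T -> R) :
  (forall i, measurable_fun setT (f i)) ->
  measurable_fun setT (fun w => \big[Num.max/c]_(i <- s) f i w).
Proof.
move=> mf; elim: s => [|i s ih].
  by under eq_fun do rewrite big_nil; exact: measurable_cst.
under eq_fun do rewrite big_cons.
exact: (measurable_maxr (mf i) ih).
Qed.

Lemma measure_bigsetU_le d (T : measurableType d) (R : realType)
    (mu : {measure set T -> \bar R}) (I : finType) (F : I -> set T) (c : R) :
  (forall i, measurable (F i)) -> (forall i, (mu (F i) <= c%:E)%E) ->
  measurable (\big[setU/set0]_i F i) /\
  (mu (\big[setU/set0]_i F i) <= (#|I|%:R * c)%:E)%E.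
Proof.
move=> mF muF.
have [mU muU] : measurable (\big[setU/set0]_i F i) /\
    (mu (\big[setU/set0]_i F i) <= \sum_(i : I) c%:E)%E.
  apply: (big_rec2 (fun x y => measurable x /\ (mu x <= y)%E)).
    by rewrite measure0.
  move=> i B y _ [mB muB]; split; first exact: measurableU.
  apply: (le_trans (measureU2 _ (mF i) mB)); exact: leeD (muF i) muB.
split=> //; rewrite (le_trans muU)// sumEFin sumr_const.
by rewrite -[X in X%:E]mulr_natl.
Qed.

Lemma normalizer_unit (R : realType) n p (dg : 'I_p -> 'M[R]_(n, p) -> R)
    (X : 'M[R]_(n, p)) : (forall k, 0 < dg k X) -> normalizer dg X \in unitmx.
Proof.
move=> dg0; rewrite unitmxE det_diag unitfE; apply/prodf_neq0 => k _.
by rewrite mxE gt_eqF.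
Qed.

Lemma vsupport_normalizer (R : realType) n p (dg : 'I_p -> 'M[R]_(n, p) -> R)
    (X : 'M[R]_(n, p)) (b : 'cV[R]_p) : (forall k, 0 < dg k X) ->
  (vsupport (invmx (normalizer dg X) *m b) \subset vsupport b)%SET.
Proof.
move=> dg0; apply/fintype.subsetP => k.
rewrite !in_vsupport; apply: contra => /eqP b0.
have := mulKVmx (normalizer_unit dg0) b; move/matrixP/(_ k 0).
rewrite /normalizer mul_diag_mx !mxE b0 => /eqP.
by rewrite mulf_eq0 gt_eqF//= mxE.
Qed.

Lemma mx_norm_le (R : realType) m n (M : 'M[R]_(m, n)) (c : R) :
  0 <= c -> (forall i j, `|M i j| <= c) -> `|M| <= c.
Proof.
by move=> c0 Mc; rewrite [leLHS]mx_normrE;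
  apply: bigmax_le => // -[i j] _; exact: Mc.
Qed.

Theorem theorem5p1 (disp : measure_display) (T : measurableType disp)
    (R : realType) (P : probability T R) (n p : nat)
    (x : 'I_n -> {RV P >-> p.-tuple R}) (u y : 'I_n -> {RV P >-> R})
    (betas : 'cV[R]_p) (dg : 'I_p -> 'M[R]_(n, p) -> R)
    (alpha Qs : R) (s : nat) :
  (0 < n)%N -> (0 < p)%N ->
  (forall i w, y i w = \sum_(k < p) tnth (x i w) k * betas k 0 + u i w) ->
  mutually_independent P (fun i w => (y i w, x i w)) ->
  (forall k w, 0 < dg k (design x w)) ->
  (forall k, measurable_fun [set: T] (fun w => dg k (design x w))) ->
  0 < alpha < 1 ->
  (forall i k, symmetric_rv P (fun w => tnth (x i w) k * u i w)) ->
  0 < Qs ->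
  (P [set w | (Qs < \big[Num.max/0]_(k < p)
       (dg k (design x w) ^+ 2 / n%:R *
        \sum_(i < n) tnth (x i w) k ^+ 2 * u i w ^+ 2))%R]
     <= (alpha / 2)%:E)%E ->
  (0 < s)%N ->
  (#|vsupport betas| <= s)%N ->
  let r := Num.sqrt (2 * ln (4 * p%:R / alpha) / n%:R) in
  exists A : set T, [/\ measurable A, ((1 - alpha)%:E <= P A)%E &
    forall w, A w ->
      let X := design x w in
      let D := normalizer dg X in
      forall gamma : R, 0 < gamma ->
        let kappa := kappa10 (Psi D X) gamma s in
        0 < kappa ->
        let c := (2 * gamma + 1) * r / kappa in
        forall (betah : 'cV[R]_p) (sigmah : R),
          self_tuned_dantzig D X (response y w) r c (betah, sigmah) ->
          let Delta := invmx D *m (betah - betas) in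
          l1norm Delta <=
            (gamma + 2) * (2 * gamma + 1) * Num.sqrt Qs / (gamma * kappa) * r /\
          (Delta^T *m Psi D X *m Delta) 0 0 <=
            (gamma + 2) * (2 * gamma + 1) ^+ 2 * Qs / (gamma ^+ 2 * kappa)
              * r ^+ 2].
Proof.
move=> n0 p0 yE indyx dg0 mdg alpha01 symZ Qs0 PQ s0 cardb r.
have n0R : 0 < n%:R :> R by rewrite ltr0n.
have p0R : 1 <= p%:R :> R by rewrite ler1n.
have [alpha0 alpha1] := andP alpha01.
have ratio_gt1 : 1 < 4 * p%:R / alpha by rewrite ltr_pdivlMr//; lra.
have ln0 := ln_gt0 ratio_gt1.
have r0 : 0 < r by rewrite sqrtr_gt0 divr_gt0// mulr_gt0.
(* So [t^2 = 2 ln(4p/alpha)]: each of the [p] tails has probability at most [alpha / (2p)], and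
   their union at most [alpha / 2]. *)
pose t := Num.sqrt n%:R * r.
have t0 : 0 < t by rewrite mulr_gt0// sqrtr_gt0.
have tE : 2 * expR (- (t ^+ 2 / 2)) = alpha / (2 * p%:R).
  rewrite /t exprMn !sqr_sqrtr ?ler0n//; last by rewrite ltW// divr_gt0// mulr_gt0.
  rewrite (_ : _ / 2 = ln (4 * p%:R / alpha)); last by field; rewrite gt_eqF.
  rewrite expRN lnK; last by rewrite posrE (lt_trans _ ratio_gt1).
  by field; rewrite ?gt_eqF// (lt_le_trans _ p0R).
have mx i k : measurable_fun setT (fun w => tnth (x i w) k).
  apply: (measurableT_comp (measurable_tnth k)); exact: measurable_funPT.
pose Z k i w := tnth (x i w) k * u i w.
have mZ k i : measurable_fun setT (Z k i).
  by apply: measurable_funM => //; exact: measurable_funPT.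
have indZ k : mutually_independent P (Z k).
  (* Independence is assumed for the pairs [(y i, x i)]; the model equation recovers the error from
     such a pair, so [Z k i] is a measurable function of it. *)
  pose f (i : 'I_n) (yx : R * p.-tuple R) :=
    tnth yx.2 k * (yx.1 - \sum_(j < p) tnth yx.2 j * betas j 0).
  have -> : Z k = fun i => f i \o (fun w => (y i w, x i w)).
    by apply/funext => i; apply/funext => w; rewrite /Z /f/= yE addrAC subrr add0r.
  apply: mutually_independent_comp indyx => i.
  have mtnth j : measurable_fun setT (fun yx : R * p.-tuple R => tnth yx.2 j).
    exact: (measurableT_comp (measurable_tnth j)).
  apply: measurable_funM => //; apply: measurable_funB => //.
  by apply: measurable_sum => j; exact: measurable_funM.
pose tail k := [set w | t * Num.sqrt (\sum_i Z k i w ^+ 2) < `|\sum_i Z k i w|].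
have mtail k : measurable (tail k).
  exact: measurable_self_normalized_tail (mZ k).
have Ptail k : (P (tail k) <= (alpha / (2 * p%:R))%:E)%E.
  by rewrite -tE; apply: (self_normalized_tail (mZ k) (indZ k) (symZ^~ k) t0).
have [mtails Ptails] := measure_bigsetU_le mtail Ptail.
set badQ := [set w | _] in PQ.
have mbadQ : measurable badQ.
  apply: measurable_set_ltr => //; apply: measurable_bigmaxr => k.
  apply: measurable_funM.
    by apply: measurable_funM => //; exact: measurable_funX.
  apply: measurable_sum => i; apply: measurable_funM; apply: measurable_funX.
    exact: mx.
  exact: measurable_funPT.
pose bad := badQ `|` \big[setU/set0]_k tail k.
have mbad : measurable bad by exact: measurableU.
have Pbad : (P bad <= alpha%:E)%E.
  rewrite (le_trans (measureU2 _ mbadQ mtails))// (le_trans (leeD PQ Ptails))//.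
  rewrite card_ord -EFinD lee_fin le_eqVlt; apply/orP; left; apply/eqP.
  by field; rewrite gt_eqF// (lt_le_trans _ p0R).
(* The event is fixed before [gamma] and the estimator are introduced, so the bounds hold for all of
   them simultaneously. *)
exists (~` bad); split; first exact: measurableC.
  by rewrite probability_setC// EFinB leeB.
move=> w /not_orP[/negP]; rewrite -leNgt => maxQ notail.
move=> X D gamma g0 kappa k0 c bh sh std Delta.
have V_le k : dg k X ^+ 2 / n%:R * (\sum_i Z k i w ^+ 2) <= Qs.
  apply: le_trans maxQ.
  under eq_bigr do rewrite /Z exprMn.
  exact: (le_bigmax _ (fun k => dg k X ^+ 2 / n%:R *
    \sum_(i < n) tnth (x i w) k ^+ 2 * u i w ^+ 2)).
have S_le k : `|\sum_i Z k i w| <= t * Num.sqrt (\sum_i Z k i w ^+ 2).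
  rewrite leNgt; apply/negP => tailk; apply: notail.
  by rewrite -bigcup_seq; exists k => //=; rewrite mem_index_enum.
have dgX k : 0 < dg k X by exact: dg0.
have sqQ : Num.sqrt Qs ^+ 2 = Qs by rewrite sqr_sqrtr// ltW.
have Db : dantzig_set D X (response y w) r (betas, Num.sqrt Qs).
  split=> /=; first by rewrite sqrtr_gt0.
  apply: mx_norm_le => [|k j]; first by rewrite mulr_ge0// ?sqrtr_ge0// ltW.
  have -> : (n%:R^-1 *: (D *m X^T *m (response y w - X *m betas))) k j =
      n%:R^-1 * (dg k X * \sum_i Z k i w).
    rewrite (ord1 j) -mulmxA mxE /D /normalizer mul_diag_mx !mxE.
    congr (_ * (_ * _)); apply: eq_bigr => i _; rewrite !mxE yE addrC.
    congr (_ * _).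
    under eq_bigr do rewrite !mxE.
    by rewrite addrA addNr add0r.
  rewrite normrM normfV (gtr0_norm n0R) normrM (gtr0_norm (dgX k)).
  (* Square root of [V_le]. With [S_le] and [t = sqrt n * r], it bounds the [k]-th score by [n^-1 *
     t * sqrt n * sqrt Qs = r * sqrt Qs]. *)
  have dgV : dg k X * Num.sqrt (\sum_i Z k i w ^+ 2) <= Num.sqrt n%:R * Num.sqrt Qs.
    rewrite -sqrtrM ?ler0n// -{1}(gtr0_norm (dgX k)) -sqrtr_sqr -sqrtrM ?sqr_ge0//.
    apply: ler_wsqrtr; have := V_le k.
    by rewrite mulrAC ler_pdivrMr// mulrC (mulrC _ Qs).
  rewrite ler_pdivrMl//; apply: le_trans (_ : dg k X * _ <= _).
    by apply: ler_wpM2l (S_le k); exact: ltW.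
  rewrite mulrCA -[X in _ <= X * _](@sqr_sqrtr _ n%:R)// /t.
  rewrite -mulrA expr2 -mulrA ler_pM2l ?sqrtr_gt0//.
  by rewrite mulrC [leRHS]mulrA ler_pM2r.
have Du : D \in unitmx by exact: normalizer_unit.
have cardJ : (#|vsupport (invmx D *m betas)| <= s)%N.
  by rewrite (leq_trans _ cardb)// subset_leq_card// vsupport_normalizer.
have := self_tuned_dantzig_bounds Du s0 cardJ r0 g0 k0 Db std.
by rewrite sqQ.
Qed.
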